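(* Let $\{(U_{k,i}, V_{k,i}); i \geq 1, k \geq 1\}$ be an array of i.i.d. two-dimensional random vectors and let $\{p_n; n \geq 1\}$ be a nondecreasing sequence of positive integers. Let $$T_n = \max_{1 \leq i \neq j \leq p_n} \Big| \sum_{k=1}^n U_{k,i} V_{k,j} \Big|, \quad n \geq 1.$$ Let $\{Y_n; n \geq 1\}$ be i.i.d. random variables with $Y_1$ having the same distribution as $U_{1,1} V_{1,2}$, and $S_n = \sum_{k=1}^n Y_k$. Let $\{a_n; n \geq 1\}$ be positive constants with $a_n \uparrow \infty$ and $$\lim_{c \downarrow 1} \limsup_{n \to \infty} \frac{a_{[cn]}}{a_n} = 1.$$ If $S_n/a_n \to 0$ in probability and $$\sum_{n=1}^{\infty} \frac{p_n^2}{n} P\Big(\frac{|S_n|}{a_n} > \lambda\Big) < \infty \quad \text{for some } 0 < \lambda < \infty,$$ then $$\limsup_{n \to \infty} \frac{T_n}{a_n} \leq \lambda \quad \text{a.s.}$$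
   Context: $[x]$ denotes the integer part of $x$. *)

(* Defs.v *)
From HB Require Import structures.
From mathcomp Require Import all_boot all_order all_algebra.
From mathcomp Require Import all_classical all_reals all_analysis.
Set Implicit Arguments. Unset Strict Implicit. Unset Printing Implicit Defensive.
Import Order.TTheory GRing.Theory Num.Theory.
Local Open Scope classical_set_scope.
Local Open Scope ring_scope.

Definition mutual_indep {d : measure_display} {T : measurableType d} {R : realType}
  (P : probability T R) {I : eqType} (D : set I)
  {d' : measure_display} {E : measurableType d'} (X : I -> T -> E) : Prop :=
  forall (J : seq I) (A : I -> set E),
    uniq J -> (forall j, j \in J -> D j) -> (forall j, j \in J -> measurable (A j)) ->
    P (\bigcap_(j in [set` J]) (X j @^-1` A j)) =
    ((\prod_(j <- J) fine (P (X j @^-1` A j)))%:E)%E.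

Definition same_law {d1 d2 : measure_display} {T1 : measurableType d1}
  {T2 : measurableType d2} {R : realType} (P1 : probability T1 R) (P2 : probability T2 R)
  {d' : measure_display} {E : measurableType d'} (X1 : T1 -> E) (X2 : T2 -> E) : Prop :=
  forall A : set E, measurable A -> P1 (X1 @^-1` A) = P2 (X2 @^-1` A).

(* T_n = max_{1 <= i <> j <= p_n} | sum_{k=1}^n U_{k,i} V_{k,j} |  (0 if the range is empty) *)
Definition Tstat {T : Type} {R : realType} (U V : nat -> nat -> T -> R) (p : nat -> nat)
  (n : nat) (x : T) : R :=
  \big[Num.max/0]_(1 <= i < (p n).+1)
    \big[Num.max/0]_(1 <= j < (p n).+1 | i != j)
      `| \sum_(1 <= k < n.+1) U k i x * V k j x |.

Definition Ssum {T : Type} {R : realType} (Y : nat -> T -> R) (n : nat) (x : T) : R :=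
  \sum_(1 <= k < n.+1) Y k x.

(* Main.v *)
(* Let N_{k+1} = N_k + [N_k / q] + 1 be blocks growing by a factor close to 1, so that
   a_m <= (1 + delta) a_{N_k} for all m <= N_{k+2}.  For i <> j the walk
   sum_k U_{k,i} V_{k,j} has the law of (S_n).  As S_n / a_n -> 0 in probability, for
   large k every increment of (S_n) up to time m has modulus at most (eps/2) a_{N_k}
   with probability at least 1/2, so Ottaviani's inequality and a union bound give,
   for every m in the *next* block [N_{k+1}, N_{k+2}),
     P(max_{n <= N_{k+1}} T_n > (lambda + eps) a_{N_k}) <= 2 p_m^2 P(|S_m| > lambda a_m).
   Averaging over that block with the weights 1/m, whose sum is at least 1/(q+1), bounds
   the left-hand sides by a block of the convergent series, and Borel-Cantelli applies. *)
Require Import Defs.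
From HB Require Import structures.
From mathcomp Require Import all_boot all_order all_algebra.
From mathcomp Require Import all_classical all_reals all_analysis.
From mathcomp Require Import measurable_realfun ring lra zify.
Import Order.TTheory GRing.Theory Num.Theory.
Local Open Scope classical_set_scope.
Local Open Scope ring_scope.

Set Implicit Arguments.
Unset Strict Implicit.
Unset Printing Implicit Defensive.

(** * Independence of generated sigma-algebras *)

(** With [B] fixed, both sides are finite measures in [A] that agree on the pi-system [G], hence on
    the sigma-algebra it generates. *)
Lemma indep_sigma1 {d : measure_display} {T : measurableType d} {R : realType}
  (P : probability T R) (G : set (set T)) (B : set T) :
  G `<=` measurable -> setI_closed G -> G setT -> measurable B ->
  (forall A, G A -> P (A `&` B) = (P A * P B)%E) ->
  forall A, <<s G >> A -> P (A `&` B) = (P A * P B)%E.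
Proof.
move=> Gm GI GT mB GB A sA.
have PB0 : (0 <= fine (P B))%R by apply: fine_ge0.
have [r rE] : exists r : {nonneg R}, (r%:num)%:E = P B.
  by exists (NngNum PB0); rewrite /= fineK// fin_num_measure.
rewrite -rE muleC.
apply: (@g_sigma_algebra_measure_unique _ _ _ G Gm (fun=> setT) (fun=> GT)
  _ (mrestr P mB) (mscale r P) GI _ _ A sA).
- by apply: bigcup_const; exists 0%N.
- by move=> C GC; rewrite /= /mrestr /mscale GB// muleC rE.
- by move=> k; rewrite /= /mrestr setTI (le_lt_trans (probability_le1 _ mB))// ltry.
Qed.

Lemma indep_sigma {d : measure_display} {T : measurableType d} {R : realType}
  (P : probability T R) (G H : set (set T)) :
  G `<=` measurable -> setI_closed G -> G setT ->
  H `<=` measurable -> setI_closed H -> H setT ->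
  (forall A B, G A -> H B -> P (A `&` B) = (P A * P B)%E) ->
  forall A B, <<s G >> A -> <<s H >> B -> P (A `&` B) = (P A * P B)%E.
Proof.
move=> Gm GI GT Hm HI HT GH A B sA sB.
have mB : measurable B.
  by move: sB; apply: smallest_sub => //; exact: sigma_algebra_measurable.
apply: (indep_sigma1 Gm GI GT mB) => // C GC.
rewrite setIC muleC; apply: (indep_sigma1 Hm HI HT) => //; first exact: Gm.
by move=> D HD; rewrite setIC muleC GH.
Qed.

(** A pi-system generating the sigma-algebra of the variables [X j], [j] in [J]; [mutual_indep] is a
    product rule for such sets. *)
Definition cylinders {T : Type} {I : eqType} {d' : measure_display} {E : measurableType d'}
    (X : I -> T -> E) (J : seq I) : set (set T) :=
  [set B | exists2 A : I -> set E,
     (forall j, measurable (A j)) & B = \bigcap_(j in [set` J]) (X j @^-1` A j)].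

Lemma cylindersI {T : Type} {I : eqType} {d' : measure_display} {E : measurableType d'}
  (X : I -> T -> E) (J : seq I) : setI_closed (cylinders X J).
Proof.
move=> _ _ [A mA ->] [B mB ->]; exists (fun j => A j `&` B j).
  by move=> j; exact: measurableI.
by rewrite -bigcapI.
Qed.

Lemma cylindersT {T : Type} {I : eqType} {d' : measure_display} {E : measurableType d'}
  (X : I -> T -> E) (J : seq I) : cylinders X J setT.
Proof. by exists (fun=> setT) => //; rewrite bigcapT. Qed.

Lemma cylinders_preimage {T : Type} {I : eqType} {d' : measure_display}
  {E : measurableType d'} (X : I -> T -> E) (J : seq I) (j : I) (A : set E) :
  j \in J -> measurable A -> cylinders X J (X j @^-1` A).
Proof.
move=> jJ mA; exists (fun i => if i == j then A else setT).
  by move=> i; case: ifP.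
apply/seteqP; split=> x /=.
  by move=> Ax i _; rewrite /preimage/=; case: eqP => // ->.
by move=> /(_ j jJ); rewrite eqxx.
Qed.

Lemma cylinders_measurable {d : measure_display} {T : measurableType d} {I : choiceType}
  {d' : measure_display} {E : measurableType d'} (X : I -> T -> E) (J : seq I) :
  (forall j, j \in J -> measurable_fun setT (X j)) -> cylinders X J `<=` measurable.
Proof.
move=> mX _ [A mA ->]; apply: fin_bigcap_measurable => // j /= jJ.
by rewrite -[X in measurable X]setTI; exact: mX.
Qed.

Lemma mutual_indep_cylinders {d : measure_display} {T : measurableType d} {R : realType}
  (P : probability T R) {I : choiceType} (D : set I)
  {d' : measure_display} {E : measurableType d'} (X : I -> T -> E) (J K : seq I) :
  mutual_indep P D X -> uniq (J ++ K) -> (forall j, j \in J ++ K -> D j) ->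
  (forall j, j \in J ++ K -> measurable_fun setT (X j)) ->
  forall A B, <<s cylinders X J >> A -> <<s cylinders X K >> B ->
  P (A `&` B) = (P A * P B)%E.
Proof.
move=> iX uJK DJK mX.
have [uJ dJK uK] : [/\ uniq J, ~~ has (mem J) K & uniq K].
  by move: uJK; rewrite cat_uniq => /and3P.
apply: indep_sigma; try exact: cylindersI; try exact: cylindersT.
- by apply: cylinders_measurable => j jJ; apply: mX; rewrite mem_cat jJ.
- by apply: cylinders_measurable => j jK; apply: mX; rewrite mem_cat jK orbT.
move=> _ _ [A mA ->] [B mB ->].
have JK j : j \in K -> (j \in J) = false.
  by move=> jK; apply/negP => jJ; move/hasPn : dJK => /(_ j jK); rewrite /= jJ.
(* As [J] and [K] are disjoint, a cylinder over [J] and one over [K] glue to a single cylinder over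
   [J ++ K]. *)
pose C j := if j \in J then A j else B j.
rewrite (iX J A)//; last by move=> j jJ; apply: DJK; rewrite mem_cat jJ.
rewrite (iX K B)//; last by move=> j jK; apply: DJK; rewrite mem_cat jK orbT.
rewrite -EFinM.
have -> : \prod_(j <- J) fine (P (X j @^-1` A j)) = \prod_(j <- J) fine (P (X j @^-1` C j)).
  by rewrite !big_seq; apply: eq_bigr => j jJ; rewrite /C jJ.
have -> : \prod_(j <- K) fine (P (X j @^-1` B j)) = \prod_(j <- K) fine (P (X j @^-1` C j)).
  by rewrite !big_seq; apply: eq_bigr => j jK; rewrite /C JK.
rewrite -big_cat -iX//; last by move=> j _; rewrite /C; case: ifP.
congr (P _); apply/seteqP; split=> x /=.
  move=> [Ax Bx] j /=; rewrite mem_cat /C /preimage/=; case: ifPn => [jJ _|_ /= jK].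
    exact: Ax.
  exact: Bx.
move=> Cx; split=> j /= j_in.
  by have := Cx j; rewrite /preimage /C /= mem_cat j_in; apply.
by have := Cx j; rewrite /preimage /C /= mem_cat j_in orbT JK//; apply.
Qed.

(** Through this, events about sums and products of the [X j] are placed in the generated
    sigma-algebra by the usual rules for measurable functions. *)
Lemma cylinders_measurable_fun {T : pointedType} {I : eqType} {d' : measure_display}
  {E : measurableType d'} (X : I -> T -> E) (J : seq I) (j : I) :
  j \in J ->
  measurable_fun setT (X j : g_sigma_algebraType (cylinders X J) -> E).
Proof.
move=> jJ _ A mA; rewrite setTI; apply: sub_gen_smallest.
exact: cylinders_preimage.
Qed.

(** * Equality in law of pairs and of partial sums *)

(** By independence the two joint laws agree on rectangles, a pi-system that generates the product
    sigma-algebra. *)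
Lemma same_law_pair {d1 d2 : measure_display} {T1 : measurableType d1}
  {T2 : measurableType d2} {R : realType} (P1 : probability T1 R) (P2 : probability T2 R)
  {dE dF dG : measure_display} {E : measurableType dE} {F : measurableType dF}
  {G : measurableType dG}
  (X1 : T1 -> E) (Z1 : T1 -> F) (X2 : T2 -> E) (Z2 : T2 -> F) (g : E * F -> G) :
  measurable_fun setT X1 -> measurable_fun setT Z1 ->
  measurable_fun setT X2 -> measurable_fun setT Z2 -> measurable_fun setT g ->
  (forall A B, measurable A -> measurable B ->
     P1 (X1 @^-1` A `&` Z1 @^-1` B) = (P1 (X1 @^-1` A) * P1 (Z1 @^-1` B))%E) ->
  (forall A B, measurable A -> measurable B ->
     P2 (X2 @^-1` A `&` Z2 @^-1` B) = (P2 (X2 @^-1` A) * P2 (Z2 @^-1` B))%E) ->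
  same_law P1 P2 X1 X2 -> same_law P1 P2 Z1 Z2 ->
  same_law P1 P2 (fun x => g (X1 x, Z1 x)) (fun x => g (X2 x, Z2 x)).
Proof.
move=> mX1 mZ1 mX2 mZ2 mg i1 i2 lX lZ C mC.
have m1 := measurable_fun_pair mX1 mZ1.
have m2 := measurable_fun_pair mX2 mZ2.
pose f1 : {mfun T1 >-> (E * F)%type} := mfun_Sub (mem_set m1).
pose f2 : {mfun T2 >-> (E * F)%type} := mfun_Sub (mem_set m2).
apply: (@measure_unique _ R (E * F)%type
  [set A `*` B | A in measurable & B in measurable] (fun=> setT) _ _ _ _
  (distribution P1 f1) (distribution P2 f2) _ _ (g @^-1` C)).
- exact: measurable_prod_measurableType.
- move=> _ _ [A1 mA1 [A2 mA2 <-]] [B1 mB1 [B2 mB2 <-]].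
  exists (A1 `&` B1); first exact: measurableI.
  exists (A2 `&` B2); first exact: measurableI.
  by rewrite setXI.
- by move=> _; exists setT => //; exists setT => //; rewrite setXTT.
- by apply: bigcup_const; exists 0%N.
- move=> _ [A mA [B mB <-]].
  have := i1 A B mA mB; have := i2 A B mA mB.
  by rewrite -lX// -lZ// => <-.
- by move=> _; rewrite (le_lt_trans (probability_le1 _ _))// ltry.
- by rewrite -[X in measurable X]setTI; exact: mg.
Qed.

Lemma same_law_sum {d1 d2 : measure_display} {T1 : measurableType d1}
  {T2 : measurableType d2} {R : realType} (P1 : probability T1 R) (P2 : probability T2 R)
  (X1 : nat -> T1 -> R) (X2 : nat -> T2 -> R) :
  (forall n, measurable_fun setT (X1 n)) -> (forall n, measurable_fun setT (X2 n)) ->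
  (forall n A B, measurable A -> measurable B ->
     P1 ((fun x => \sum_(0 <= k < n) X1 k x) @^-1` A `&` X1 n @^-1` B) =
     (P1 ((fun x => \sum_(0 <= k < n) X1 k x)%R @^-1` A) * P1 (X1 n @^-1` B))%E) ->
  (forall n A B, measurable A -> measurable B ->
     P2 ((fun x => \sum_(0 <= k < n) X2 k x) @^-1` A `&` X2 n @^-1` B) =
     (P2 ((fun x => \sum_(0 <= k < n) X2 k x)%R @^-1` A) * P2 (X2 n @^-1` B))%E) ->
  (forall n, same_law P1 P2 (X1 n) (X2 n)) ->
  forall n, same_law P1 P2 (fun x => \sum_(0 <= k < n) X1 k x)
                           (fun x => \sum_(0 <= k < n) X2 k x).
Proof.
move=> m1 m2 i1 i2 lX; elim=> [|n IH].
  move=> A mA; rewrite /preimage.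
  under eq_set do rewrite big_geq//.
  under [in RHS]eq_set do rewrite big_geq//.
  have [A0|A0] := pselect (A 0).
    rewrite (_ : [set _ | _] = setT); last by apply/seteqP; split.
    by rewrite (_ : [set _ | _] = setT) ?probability_setT//; apply/seteqP; split.
  rewrite (_ : [set _ | _] = set0); last by apply/seteqP; split.
  by rewrite (_ : [set _ | _] = set0) ?measure0//; apply/seteqP; split.
have recr T (X : nat -> T -> R) : (fun x => \sum_(0 <= k < n.+1) X k x) =
    (fun x => \sum_(0 <= k < n) X k x + X n x).
  by apply/funext => x; rewrite big_nat_recr.
rewrite !recr.
apply: (@same_law_pair _ _ _ _ _ P1 P2 _ _ _ _ _ _ (fun x => \sum_(0 <= k < n) X1 k x) (X1 n)
   (fun x => \sum_(0 <= k < n) X2 k x) (X2 n) (fun z => z.1 + z.2)) => //.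
- exact: measurable_sum.
- exact: measurable_sum.
- by apply: measurable_funD; [exact: measurable_fst|exact: measurable_snd].
- exact: i1.
- exact: i2.
Qed.

(** * Maximal inequality and union bound *)

(* Ottaviani's inequality: on the event that the walk first exceeds [x + y] at time
   [n], an increment [S m - S n] of size at most [y], which is independent of that
   event and has probability at least 1/2, forces [x < `|S m|]. *)
Lemma ottaviani {d : measure_display} {T : measurableType d} {R : realType}
  (P : probability T R) (S : nat -> T -> R) (m : nat) (x y : R)
  (E := fun n => [set w | x + y < `|S n w|]) :
  (forall n, measurable_fun setT (S n)) ->
  (forall n, (n <= m)%N -> P (seqDU E n `&` [set w | `|S m w - S n w| <= y]) =
     (P (seqDU E n) * P [set w | (`|S m w - S n w| <= y)%R])%E) ->
  (forall n, (n <= m)%N -> (P [set w | (y < `|S m w - S n w|)%R] <= (2^-1)%:E)%E) ->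
  (P (\big[setU/set0]_(n < m.+1) E n) <= 2%:E * P [set w | (x < `|S m w|)%R])%E.
Proof.
move=> mS iS hS.
have mE n : measurable (E n).
  rewrite -[X in measurable X]setTI.
  by apply: (measurable_fun_ltr (measurable_cst _)) => //; exact: measurableT_comp.
have mD n : measurable (seqDU E n).
  by apply: measurableD => //; exact: bigsetU_measurable.
pose F n := [set w | `|S m w - S n w| <= y].
have mF n : measurable (F n).
  rewrite -[X in measurable X]setTI.
  apply: measurable_fun_ler => //.
  by apply: measurableT_comp => //; exact: measurable_funB.
have tD := @trivIset_seqDU _ E.
have tDF : trivIset setT (fun n => seqDU E n `&` F n).
  by apply/trivIsetP => i j _ _ ij; rewrite setIACA; move/trivIsetP : tD => ->//; rewrite set0I.
have mDF n : measurable (seqDU E n `&` F n) by exact: measurableI.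
rewrite bigsetU_seqDU measure_bigsetU//.
apply: (@le_trans _ _ (\sum_(n < m.+1) 2%:E * P (seqDU E n `&` F n))%E).
  apply: lee_sum => -[n /=]; rewrite ltnS => nm _.
  have F2 : ((2^-1)%:E <= P (F n))%E.
    have -> : F n = ~` [set w | y < `|S m w - S n w|].
      by apply/seteqP; split=> w /=; rewrite /F/= leNgt => /negP.
    rewrite probability_setC; last first.
      rewrite -[X in measurable X]setTI; apply: measurable_fun_ltr => //.
      by apply: measurableT_comp => //; exact: measurable_funB.
    rewrite (_ : (2^-1)%:E = (1 - (2^-1)%:E)%E :> \bar R).
      by apply: leeB => //; exact: hS.
    by rewrite -EFinB; congr EFin; lra.
  (* By independence the factor 2 makes up for [P (F n)], which is at least 1/2. *)
  rewrite iS// muleCA -[leLHS]mule1; apply: lee_wpmul2l => //.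
  rewrite (_ : 1%E = (2%:E * (2^-1)%:E)%E); last by rewrite -EFinM divff.
  exact: lee_wpmul2l.
rewrite -ge0_sume_distrr//.
apply: lee_wpmul2l => //; rewrite -(measure_bigsetU P mDF tDF).
apply: le_measure; rewrite ?inE.
- exact: bigsetU_measurable.
- rewrite -[X in measurable X]setTI.
  by apply: (measurable_fun_ltr (measurable_cst _)) => //; exact: measurableT_comp.
- move=> w; rewrite -(bigcup_mkord _ (fun n => seqDU E n `&` F n)) => -[n /= nm [[En _] Fn]].
  rewrite /E/= in En; rewrite /F/= in Fn.
  have : `|S n w| <= `|S m w| + `|S m w - S n w|.
    rewrite [in leLHS](_ : S n w = S m w - (S m w - S n w)); last by ring.
    exact: ler_normB.
  by lra.
Qed.

(** Measurability is asked only inside the range, because a sigma-algebra generated by some rows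
    sees only the terms of those rows. *)
Lemma measurable_sum_nat {d : measure_display} {T : measurableType d} {R : realType}
  (f : nat -> T -> R) (a b : nat) :
  (forall k, (a <= k < b)%N -> measurable_fun setT (f k)) ->
  measurable_fun setT (fun x => \sum_(a <= k < b) f k x).
Proof.
move=> mf; have -> : (fun x => \sum_(a <= k < b) f k x) =
    (fun x => \sum_(a <= k < b) (if (a <= k < b)%N then f k else cst 0) x).
  by apply/funext => x; apply: eq_big_nat => k ->.
by apply: measurable_sum => k; case: ifPn => [/mf//|_]; exact: measurable_cst.
Qed.

Lemma mutual_indep_sum {d : measure_display} {T : measurableType d} {R : realType}
  (P : probability T R) (Y : nat -> T -> R) :
  (forall n, measurable_fun setT (Y n)) -> mutual_indep P [set n | (1 <= n)%N] Y ->
  forall n A B, measurable A -> measurable B ->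
  P ((fun x => \sum_(0 <= k < n) Y k.+1 x)%R @^-1` A `&` Y n.+1 @^-1` B) =
  (P ((fun x => \sum_(0 <= k < n) Y k.+1 x)%R @^-1` A) * P (Y n.+1 @^-1` B))%E.
Proof.
move=> mY iY n A B mA mB.
apply: (@mutual_indep_cylinders _ _ _ P _ _ _ _ Y (iota 1 n) [:: n.+1] iY) => //.
- by rewrite cat_uniq iota_uniq/= mem_iota add1n ltnn andbF.
- by move=> j; rewrite mem_cat mem_iota inE => /orP[/andP[]|/eqP ->].
- rewrite -[X in <<s _ >> X]setTI.
  apply: (@measurable_sum_nat _ (g_sigma_algebraType (cylinders Y (iota 1 n))) R
    (fun k => Y k.+1) 0 n) => // k /andP[_ kn].
  by apply: cylinders_measurable_fun; rewrite mem_iota/= add1n ltnS.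
- by apply: sub_gen_smallest; apply: cylinders_preimage => //; rewrite inE.
Qed.

Lemma probability_union_bound {d : measure_display} {T : measurableType d} {R : realType}
  (P : probability T R) {I : eqType} (s : seq I) (Q : pred I) (F : I -> set T) (c : \bar R) :
  (forall i, measurable (F i)) -> (0 <= c)%E ->
  (forall i, i \in s -> Q i -> (P (F i) <= c)%E) ->
  (P (\big[setU/set0]_(i <- s | Q i) F i) <= (size s)%:R%:E * c)%E.
Proof.
move=> mF c0; elim: s => [|i s IH] Fc; first by rewrite big_nil measure0 mul0e.
have {}IH : (P (\big[setU/set0]_(i <- s | Q i) F i) <= (size s)%:R%:E * c)%E.
  by apply: IH => j js; apply: Fc; rewrite inE js orbT.
rewrite big_cons /= -natr1 EFinD ge0_muleDl ?lee_fin// mul1e.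
case: ifPn => Qi; last by rewrite (le_trans IH)// leeDl.
rewrite addeC; apply: le_trans (measureU2 _ _ _) _ => //.
  exact: bigsetU_measurable.
by apply: leeD => //; apply: Fc => //; rewrite inE eqxx.
Qed.

(** * The walks of the array: independence, law, maximal inequality *)

Section product_array.
Context {R : realType} {d : measure_display} {T : measurableType d}
  (P : probability T R) (U V : nat -> nat -> T -> R)
  {d' : measure_display} {T' : measurableType d'} (P' : probability T' R)
  (Y : nat -> T' -> R).
Hypothesis mU : forall k i, measurable_fun setT (U k i).
Hypothesis mV : forall k i, measurable_fun setT (V k i).
Hypothesis iUV : mutual_indep P [set ki : nat * nat | (1 <= ki.1)%N /\ (1 <= ki.2)%N]
  (fun ki x => (U ki.1 ki.2 x, V ki.1 ki.2 x)).
Hypothesis lUV : forall k i, (1 <= k)%N -> (1 <= i)%N ->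
  same_law P P (fun x => (U k i x, V k i x)) (fun x => (U 1%N 1%N x, V 1%N 1%N x)).
Hypothesis mY : forall n, measurable_fun setT (Y n).
Hypothesis iY : mutual_indep P' [set n : nat | (1 <= n)%N] Y.
Hypothesis lY : forall n, (1 <= n)%N -> same_law P' P' (Y n) (Y 1%N).
Hypothesis lYUV : same_law P' P (Y 1%N) (fun x => U 1%N 1%N x * V 1%N 2%N x).

Let X (ki : nat * nat) (x : T) : R * R := (U ki.1 ki.2 x, V ki.1 ki.2 x).

Let mX ki : measurable_fun setT (X ki).
Proof. exact: measurable_fun_pair. Qed.

(** The entries in rows [a <= k < b] and columns [i], [j], on which the products [U k i * V k j] of
    these rows depend. *)
Let window (i j a b : nat) : seq (nat * nat) :=
  [seq (k, l) | k <- index_iota a b, l <- [:: i; j]].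

Let windowE i j a b k l :
  ((k, l) \in window i j a b) = (a <= k < b)%N && ((l == i) || (l == j)).
Proof.
apply/allpairsP/andP => [[[k' l']/= []]|[kab lij]].
  by rewrite mem_index_iota !inE => kab lij [-> ->].
by exists (k, l); rewrite mem_index_iota !inE/=.
Qed.

Let window_uniq i j a b c : i != j -> uniq (window i j a b ++ window i j b c).
Proof.
move=> ij.
have u a' b' : uniq (window i j a' b').
  apply: allpairs_uniq; first exact: iota_uniq.
    by rewrite /= inE ij.
  by move=> [? ?] [? ?].
rewrite cat_uniq !u andbT/=; apply/hasPn => -[k l].
by rewrite /= !windowE => /andP[/andP[bk _] _]; rewrite (ltnNge k) bk andbF.
Qed.

(** Consecutive windows share no entry, so the past and the future of a walk are independent. *)
Let window_indep i j a b c : (0 < i)%N -> (0 < j)%N -> i != j -> (0 < a <= b)%N ->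
  forall A B, <<s cylinders X (window i j a b) >> A ->
  <<s cylinders X (window i j b c) >> B -> P (A `&` B) = (P A * P B)%E.
Proof.
move=> i0 j0 ij /andP[a0 ab].
apply: (mutual_indep_cylinders iUV); first exact: window_uniq; last first.
  by move=> kl _; exact: mX.
move=> [k l]; rewrite mem_cat !windowE => kl; split=> /=.
  by case/orP: kl => /andP[/andP[? _] _]; lia.
by case/orP: kl => /andP[_ /orP[] /eqP ->].
Qed.

Let W i j k x := U k i x * V k j x.

Let mW i j k : measurable_fun setT (W i j k).
Proof. exact: measurable_funM. Qed.

Let window_measurable_prod i j a b k : (a <= k < b)%N ->
  measurable_fun setT
    (W i j k : g_sigma_algebraType (cylinders X (window i j a b)) -> R).
Proof.
move=> kab.
have mk l : (l == i) || (l == j) -> measurable_fun setT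
    (X (k, l) : g_sigma_algebraType (cylinders X (window i j a b)) -> (R * R)%type).
  by move=> lij; apply: cylinders_measurable_fun; rewrite windowE kab.
apply: (@measurable_funM _ (g_sigma_algebraType (cylinders X (window i j a b))) R _
  (fst \o X (k, i)) (snd \o X (k, j))).
  by apply: (measurableT_comp measurable_fst); apply: mk; rewrite eqxx.
by apply: (measurableT_comp measurable_snd); apply: mk; rewrite eqxx orbT.
Qed.

Let window_measurable_sum i j a b a' b' : (a <= a')%N -> (b' <= b)%N ->
  measurable_fun setT
    ((fun x => \sum_(a' <= k < b') W i j k x) :
      g_sigma_algebraType (cylinders X (window i j a b)) -> R).
Proof.
move=> aa bb.
apply: (@measurable_sum_nat _ (g_sigma_algebraType (cylinders X (window i j a b))) R).
by move=> k /andP[? ?]; apply: window_measurable_prod; lia.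
Qed.

(** As [i != j], the factors come from different vectors of the array, so they are independent;
    their marginal laws do not depend on the position. *)
Let W_law i j k l : (0 < i)%N -> (0 < j)%N -> i != j -> (0 < k)%N -> (0 < l)%N ->
  same_law P P' (W i j k) (Y l).
Proof.
move=> i0 j0 ij k0 l0 A mA; rewrite lY// lYUV//.
have indep_entries k' i' j' : (0 < k')%N -> (0 < i')%N -> (0 < j')%N -> i' != j' ->
    forall B C, measurable B -> measurable C ->
    P (U k' i' @^-1` B `&` V k' j' @^-1` C) =
    (P (U k' i' @^-1` B) * P (V k' j' @^-1` C))%E.
  move=> k'0 i'0 j'0 ij' B C mB mC.
  apply: (@mutual_indep_cylinders _ _ _ P _ _ _ _ X [:: (k', i')] [:: (k', j')] iUV) => //.
  - by rewrite /= inE xpair_eqE eqxx ij'.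
  - by move=> l'; rewrite !inE => /orP[] /eqP ->.
  - apply: sub_gen_smallest.
    rewrite (_ : _ @^-1` _ = X (k', i') @^-1` (B `*` setT)).
      by apply: cylinders_preimage; [rewrite inE|exact: measurableX].
    by apply/seteqP; split=> x //= [].
  - apply: sub_gen_smallest.
    rewrite (_ : _ @^-1` _ = X (k', j') @^-1` (setT `*` C)).
      by apply: cylinders_preimage; [rewrite inE|exact: measurableX].
    by apply/seteqP; split=> x //= [].
have lU k' i' : (0 < k')%N -> (0 < i')%N -> same_law P P (U k' i') (U 1%N 1%N).
  move=> k'0 i'0 B mB; have := lUV k'0 i'0 (measurableX mB measurableT).
  have E k2 i2 : (fun x => (U k2 i2 x, V k2 i2 x)) @^-1` (B `*` setT) = U k2 i2 @^-1` B.
    by apply/seteqP; split=> x //= [].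
  by rewrite !E.
have lV k' i' : (0 < k')%N -> (0 < i')%N -> same_law P P (V k' i') (V 1%N 1%N).
  move=> k'0 i'0 B mB; have := lUV k'0 i'0 (measurableX measurableT mB).
  have E k2 i2 : (fun x => (U k2 i2 x, V k2 i2 x)) @^-1` (setT `*` B) = V k2 i2 @^-1` B.
    by apply/seteqP; split=> x //= [].
  by rewrite !E.
suff : same_law P P (W i j k) (fun x => U 1%N 1%N x * V 1%N 2%N x) by apply.
apply: (@same_law_pair _ _ _ _ _ P P _ _ _ _ _ _ (U k i) (V k j) (U 1%N 1%N) (V 1%N 2%N)
  (fun z => z.1 * z.2)) => //.
- by apply: measurable_funM; [exact: measurable_fst|exact: measurable_snd].
- exact: indep_entries.
- exact: indep_entries.
- exact: lU.
- by move=> B mB; rewrite lV// [RHS]lV.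
Qed.

(** The start [n] is free so that this serves both the whole walk ([n = 1]) and its increments. *)
Let W_sum_law i j n l : (0 < i)%N -> (0 < j)%N -> i != j -> (0 < n)%N ->
  same_law P P' (fun x => \sum_(n <= k < n + l) W i j k x) (Ssum Y l).
Proof.
move=> i0 j0 ij n0.
have WE l' : (fun x => \sum_(n <= k < n + l') W i j k x) =
    (fun x => \sum_(0 <= k < l') W i j (k + n) x).
  apply/funext => x; rewrite -[X in \sum_(X <= _ < _) _]add0n big_addn.
  by rewrite addKn.
have SE : Ssum Y l = (fun x => \sum_(0 <= k < l) Y k.+1 x).
  by apply/funext => x; rewrite /Ssum big_add1.
rewrite WE SE; apply: same_law_sum => //.
- move=> l' A B mA mB; rewrite -WE.
  apply: (@window_indep i j n (n + l') (n + l').+1) => //.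
  + by rewrite n0 leq_addr.
  + rewrite -[X in <<s _ >> X]setTI.
    exact: (@window_measurable_sum i j n (n + l') n (n + l')).
  + rewrite -[X in <<s _ >> X]setTI addnC.
    by apply: (@window_measurable_prod i j) => //; rewrite leqnn ltnS leqnn.
- exact: mutual_indep_sum.
- by move=> l'; apply: W_law => //; rewrite ?addn_gt0 ?n0 ?orbT.
Qed.

(** Ottaviani's inequality for one walk. An increment over [l] steps has the law of [Ssum Y l],
    which is why [hY] covers all [l <= m]. *)
Lemma array_maximal_inequality (i j m : nat) (x y : R) :
  (0 < i)%N -> (0 < j)%N -> i != j ->
  (forall l, (l <= m)%N -> (P' [set w | (y < `|Ssum Y l w|)%R] <= (2^-1)%:E)%E) ->
  (P (\big[setU/set0]_(n < m.+1)
        [set w | (x + y < `|\sum_(1 <= k < n.+1) U k i w * V k j w|)%R]) <=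
   2%:E * P' [set w | (x < `|Ssum Y m w|)%R])%E.
Proof.
move=> i0 j0 ij hY.
pose S n w := \sum_(1 <= k < n.+1) W i j k w.
have mS n : measurable_fun setT (S n) by exact: measurable_sum.
have incr n : (n <= m)%N ->
    (fun w => S m w - S n w) = (fun w => \sum_(n.+1 <= k < m.+1) W i j k w).
  move=> nm; apply/funext => w; rewrite /S (big_cat_nat (n := n.+1))//=.
  by rewrite addrAC subrr add0r.
have mabs c : measurable [set r : R | c < `|r|].
  rewrite -[X in measurable X]setTI.
  by apply: (measurable_fun_ltr (measurable_cst _)) => //; exact: measurableT_comp.
have mabs' c : measurable [set r : R | `|r| <= c].
  rewrite -[X in measurable X]setTI.
  by apply: (measurable_fun_ler _ (measurable_cst _)) => //; exact: measurableT_comp.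
have -> : P' [set w | (x < `|Ssum Y m w|)%R] = P [set w | (x < `|S m w|)%R].
  by have := @W_sum_law i j 1 m i0 j0 ij isT _ (mabs x); rewrite add1n => <-.
apply: (@ottaviani _ _ _ P S m x y) => // n nm.
  (* First passage at time [n] is decided by rows [1] to [n], the increment by rows [n.+1] to
     [m]. *)
  apply: (@window_indep i j 1 n.+1 m.+1) => //.
    have mE k : (k <= n)%N ->
        @measurable _ (g_sigma_algebraType (cylinders X (window i j 1 n.+1)))
          [set w | x + y < `|S k w|].
      move=> kn; rewrite -[X in measurable X]setTI.
      have mSk := @window_measurable_sum i j 1 n.+1 1 k.+1 (leqnn _) kn.
      exact: (mSk measurableT _ (mabs (x + y))).
    apply: (@measurableD _ (g_sigma_algebraType (cylinders X (window i j 1 n.+1)))).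
      exact: mE.
    by apply: bigsetU_measurable => k _; apply: mE; exact: ltnW.
  rewrite (_ : [set w | _] = (fun w => S m w - S n w) @^-1` [set r | `|r| <= y])//.
  rewrite incr// -[X in <<s _ >> X]setTI.
  have mSmn := @window_measurable_sum i j n.+1 m.+1 n.+1 m.+1 (leqnn _) (leqnn _).
  exact: (mSmn measurableT _ (mabs' y)).
have := @W_sum_law i j n.+1 (m - n) i0 j0 ij isT _ (mabs y).
rewrite addSn subnKC// => e; apply: le_trans (hY (m - n)%N (leq_subr _ _)).
rewrite -[leRHS]e -incr//.
Qed.

(** At most [r ^ 2] pairs occur. Keeping [M] apart from [m] lets one event be bounded through every
    [m] of the next block. *)
Lemma array_union_bound (r m M : nat) (x y : R) : (M <= m)%N ->
  (forall l, (l <= m)%N -> (P' [set w | (y < `|Ssum Y l w|)%R] <= (2^-1)%:E)%E) ->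
  (P (\big[setU/set0]_(1 <= i < r.+1) \big[setU/set0]_(1 <= j < r.+1 | i != j)
        \big[setU/set0]_(n < M.+1)
        [set w | (x + y < `|\sum_(1 <= k < n.+1) U k i w * V k j w|)%R]) <=
   (r%:R ^+ 2)%:E * (2%:E * P' [set w | (x < `|Ssum Y m w|)%R]))%E.
Proof.
move=> Mm hY.
pose E i j n := [set w | x + y < `|\sum_(1 <= k < n.+1) U k i w * V k j w|].
have mE i j n : measurable (E i j n).
  rewrite -[X in measurable X]setTI.
  apply: (measurable_fun_ltr (measurable_cst _)) => //; apply: measurableT_comp => //.
  by apply: measurable_sum => k; exact: (mW i j k).
have mEM i j b : measurable (\big[setU/set0]_(n < b) E i j n) by exact: bigsetU_measurable.
have size_r : size (index_iota 1 r.+1) = r by rewrite size_iota subn1.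
have c0 : (0 <= 2%:E * P' [set w | (x < `|Ssum Y m w|)%R])%E by rewrite mule_ge0.
rewrite expr2 EFinM -muleA -[in leRHS]size_r.
apply: (@probability_union_bound _ _ _ P _ (index_iota 1 r.+1) xpredT).
- by move=> i; apply: bigsetU_measurable => j _; exact: mEM.
- by rewrite mule_ge0// lee_fin.
move=> i; rewrite mem_index_iota => /andP[i0 _] _.
apply: (@probability_union_bound _ _ _ P _ (index_iota 1 r.+1) (fun j => i != j)
  (fun j => \big[setU/set0]_(n < M.+1) E i j n)) => //.
move=> j; rewrite mem_index_iota => /andP[j0 _] ij.
apply: le_trans (array_maximal_inequality x i0 j0 ij hY).
apply: le_measure; rewrite ?inE; [exact: mEM|exact: (mEM i j m.+1)|].
rewrite -!(bigcup_mkord _ (E i j)) => w [n /= nM Enw].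
by exists n => //=; exact: leq_trans nM _.
Qed.

End product_array.

(** * Tightness, and slow growth of the normalising constants *)

(** The events where [f] exceeds [n] in modulus decrease to the empty set; continuity from above
    applies. *)
Lemma probability_norm_gt_half {d : measure_display} {T : measurableType d} {R : realType}
  (P : probability T R) (f : T -> R) :
  measurable_fun setT f ->
  exists t, forall s, t <= s -> (P [set w | (s < `|f w|)%R] <= (2^-1)%:E)%E.
Proof.
move=> mf.
have mF s : measurable [set w | s < `|f w|].
  rewrite -[X in measurable X]setTI.
  by apply: (measurable_fun_ltr (measurable_cst _)) => //; exact: measurableT_comp.
pose F (n : nat) := [set w | n%:R < `|f w|].
have F0 : \bigcap_n F n = set0.
  apply/seteqP; split=> // w /(_ (Num.truncn `|f w|).+1 I); rewrite /F/=.
  by apply/negP; rewrite -leNgt ltW// truncnS_gt.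
have Foo : (P (F 0%N) < +oo)%E.
  by rewrite (le_lt_trans (probability_le1 _ (mF _)))// ltry.
have Fni : {homo F : n m / (n <= m)%N >-> (m <= n)%O}.
  move=> n m nm; apply/subsetPset => w; rewrite /F/=.
  by apply: le_lt_trans; rewrite ler_nat.
have mF0 : measurable (\bigcap_n F n) by rewrite F0.
have := nonincreasing_cvg_mu Foo (fun n => mF n%:R) mF0 Fni.
rewrite F0 measure0 => /(_ _ (@nbhs_open_ereal_lt _ 0 (fun=> 2^-1) _))[].
  by rewrite invr_gt0.
move=> n _ /(_ n (leqnn _)) /= Fn; exists n%:R => s ns.
apply: le_trans (ltW Fn); apply: le_measure; rewrite ?inE//; first exact: mF.
by move=> w /=; apply: le_lt_trans.
Qed.

(* For [l >= L] convergence in probability at time [l] applies directly since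
   [a l <= a m <= 2 * a N]; the finitely many [l < L] are handled by [a N -> +oo]. *)
Lemma uniform_half_bound {d : measure_display} {T : measurableType d} {R : realType}
  (P : probability T R) (S : nat -> T -> R) (a : nat -> R) (e : R) :
  (forall n, measurable_fun setT (S n)) -> 0 < e ->
  (forall n, (1 <= n)%N -> 0 < a n) ->
  (forall m n, (1 <= m)%N -> (m <= n)%N -> a m <= a n) ->
  ((fun n => (a n)%:E) @ \oo --> +oo%E) ->
  (forall eps : R, 0 < eps ->
     (fun n => P [set x | eps < `| S n x / a n |]) @ \oo --> 0%E) ->
  exists N0, forall N m l, (N0 <= N)%N -> a m <= 2 * a N -> (l <= m)%N ->
    (P [set w | (e * a N < `|S l w|)%R] <= (2^-1)%:E)%E.
Proof.
move=> mS e0 a0 a_nd a_oo Sa0.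
have mabs s l : measurable [set w | s < `|S l w|].
  rewrite -[X in measurable X]setTI.
  by apply: (measurable_fun_ltr (measurable_cst _)) => //; exact: measurableT_comp.
have e20 : 0 < e / 2 by exact: divr_gt0.
have [L _ hL] : \forall l \near \oo, (P [set x | (e / 2 < `| S l x / a l |)%R] <= (2^-1)%:E)%E.
  have := Sa0 _ e20 _ (@nbhs_open_ereal_lt _ 0 (fun=> 2^-1) _) => /(_ _)[].
    by rewrite invr_gt0.
  by move=> L _ hL; exists L => // l /hL /= /ltW.
have [t ht] : exists t, forall l s, (l < L.+1)%N -> t <= s ->
    (P [set w | (s < `|S l w|)%R] <= (2^-1)%:E)%E.
  elim: (L.+1) => [|L' [t ht]]; first by exists 0.
  have [t' ht'] := probability_norm_gt_half P (mS L').
  exists (Num.max t t') => l s; rewrite ltnS leq_eqVlt ge_max => /predU1P[->|lL'] /andP[ts t's].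
    exact: ht'.
  exact: ht.
have [N0 _ hN0] : \forall n \near \oo, ((t / e)%:E <= (a n)%:E)%E.
  by move/cvgeyPge : a_oo; apply.
exists (maxn N0 1) => N m l; rewrite geq_max => /andP[N0N N1] amN lm.
have [lL|Ll] := ltnP l L.+1.
  apply: ht => //; have := hN0 N N0N; rewrite /= lee_fin ler_pdivrMr//.
  by rewrite mulrC.
have l0 : (0 < l)%N by exact: leq_ltn_trans Ll.
have l1 := a0 _ l0.
apply: le_trans (hL l (ltnW Ll)); apply: le_measure; rewrite ?inE//.
  rewrite -[X in measurable X]setTI; apply: (measurable_fun_ltr (measurable_cst _)) => //.
  by apply: measurableT_comp => //; exact: measurable_funM.
move=> w /=; rewrite normrM normfV (gtr0_norm l1) ltr_pdivlMr// => h.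
apply: le_lt_trans h; have := a_nd _ _ l0 lm.
nra.
Qed.

(** Some [c > 1] has limsup below [1 + delta], so some tail supremum is below it too; monotonicity
    passes from [[c N]] to all smaller [m]. *)
Lemma slow_growth {R : realType} (a : nat -> R) (delta : R) :
  ((fun c : R => limn_esup (fun n => (a (Num.truncn (c * n%:R)) / a n)%:E))
     @ 1^'+ --> 1%:E) ->
  (forall n, (1 <= n)%N -> 0 < a n) ->
  (forall m n, (1 <= m)%N -> (m <= n)%N -> a m <= a n) -> 0 < delta ->
  exists2 c : R, 1 < c & exists N0, forall N m, (N0 <= N)%N -> (1 <= m)%N ->
     m%:R <= c * N%:R -> a m <= (1 + delta) * a N.
Proof.
move=> alim a0 a_nd d0.
have d1 : 1 < 1 + delta by rewrite ltrDl.
have near_c : \forall c \near (1 : R)^'+,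
    (limn_esup (fun n => (a (Num.truncn (c * n%:R)) / a n)%:E) < (1 + delta)%:E)%E.
  exact: (alim _ (@nbhs_open_ereal_lt _ 1 (fun=> 1 + delta) d1)).
have [c [/= ac c1]] := filter_ex (filterI near_c (nbhs_right_gt (1 : R))).
exists c => //.
move/ereal_inf_lt : ac => [_ [A [N0 _ N0A] <-]] Alt.
exists (maxn N0 1) => N m; rewrite geq_max => /andP[N0N N1] m1 mN.
have mt : (m <= Num.truncn (c * N%:R))%N by rewrite truncn_ge_nat// (le_trans _ mN).
apply: le_trans (a_nd _ _ m1 mt) _.
rewrite -ler_pdivrMr ?a0// -lee_fin; apply: le_trans (ltW Alt).
by apply: ereal_sup_ubound; exists N => //; exact: N0A.
Qed.

(** * Blocks growing by a factor close to 1 *)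

Definition block (q N0 k : nat) : nat := iter k (fun N => N + (N %/ q).+1)%N N0.
Arguments block : simpl never.

Lemma blockS q N0 k : block q N0 k.+1 = (block q N0 k + (block q N0 k %/ q).+1)%N.
Proof. by []. Qed.

Lemma leq_block q N0 : {homo block q N0 : k l / (k <= l)%N >-> (k <= l)%N}.
Proof.
move=> k l /subnKC <-; elim: (l - k)%N => [|n IH]; first by rewrite addn0.
by rewrite addnS blockS (leq_trans IH)// leq_addr.
Qed.

Lemma block_ge q N0 k : (N0 + k <= block q N0 k)%N.
Proof. by elim: k => [|k IH]; rewrite ?addn0// addnS blockS addnS ltnS (leq_trans IH)// leq_addr. Qed.

Lemma block_cover q N0 K n : (block q N0 K <= n)%N ->
  exists2 k, (K <= k)%N & (block q N0 k <= n < block q N0 k.+1)%N.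
Proof.
move=> Kn.
have ex : exists k, (n < block q N0 k)%N by exists n.+1; have := block_ge q N0 n.+1; lia.
case: (ex_minnP ex) => -[|k] nk kmin.
  by move: nk; rewrite ltnNge (leq_trans (@leq_block q N0 0 K (leq0n _)) Kn).
exists k; last by rewrite nk andbT leqNgt; apply/negP => /kmin; rewrite ltnn.
by rewrite leqNgt; apply/negP => /(@leq_block q N0); lia.
Qed.

(** For [n >= q] one step multiplies by at most [1 + 2/q], and [(1 + 2/q)^2 <= 1 + 8/q] as
    [q >= 1]. *)
Lemma blockSS_le q N0 k : (0 < q)%N -> (q <= N0)%N ->
  (q * block q N0 k.+2 <= (q + 8) * block q N0 k)%N.
Proof.
move=> q0 qN0; rewrite 2!blockS; set N := block q N0 k.
have qN : (q <= N)%N by have := block_ge q N0 k; rewrite -/N; lia.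
have h n : (q <= n)%N -> (q * (n + (n %/ q).+1) <= (q + 2) * n)%N.
  by move: (n %/ q)%N (leq_divM n q) => D; nia.
set N' := (N + _)%N.
have qN' : (q <= N')%N by exact: leq_trans (leq_addr _ _).
have h1 : (q * N' <= (q + 2) * N)%N by exact: h.
move: (h _ qN'); move: (N' + _)%N => N'' h2.
rewrite -(leq_pmul2l q0); apply: leq_trans (leq_mul (leqnn q) h2) _.
rewrite mulnCA; apply: leq_trans (leq_mul (leqnn (q + 2)) h1) _.
by nia.
Qed.

(** With [D = N %/ q] the width is [D + 1], while [N < q (D + 1)]. *)
Lemma blockS_width q N0 k : (0 < q)%N ->
  (block q N0 k.+1 <= q.+1 * (block q N0 k.+1 - block q N0 k))%N.
Proof.
move=> q0; rewrite blockS; set N := block q N0 k; rewrite addKn.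
by move: (N %/ q)%N (ltn_ceil N q0) => D; nia.
Qed.

(** Each [g m] is at least [b / m], hence at least [b / N'] with [N'] the end of the block;
    [blockS_width] counts the terms. *)
Lemma le_block_sum {R : realType} (q N0 k : nat) (b : R) (g : nat -> R) :
  (0 < q)%N -> (0 < N0)%N -> 0 <= b ->
  (forall m, (block q N0 k <= m < block q N0 k.+1)%N -> b <= m%:R * g m) ->
  b <= q.+1%:R * \sum_(block q N0 k <= m < block q N0 k.+1) g m.
Proof.
move=> q0 N00 b0 bg; set N := block q N0 k; set N' := block q N0 k.+1.
have N_gt0 : (0 < N)%N by have := block_ge q N0 k; rewrite -/N; lia.
have NN' : (N <= N')%N by exact: leq_block.
have N'_gt0 : 0 < N'%:R :> R by rewrite ltr0n; lia.
have : \sum_(N <= m < N') b / N'%:R <= \sum_(N <= m < N') g m.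
  apply: ler_sum_nat => m /andP[Nm mN'].
  have m0 : 0 < m%:R :> R by rewrite ltr0n; lia.
  apply: (@le_trans _ _ (b / m%:R)).
    by rewrite ler_wpM2l// lef_pV2// ler_nat ltnW.
  by rewrite ler_pdivrMr// mulrC; apply: bg; rewrite Nm.
rewrite sumr_const_nat => h.
have w : N'%:R <= q.+1%:R * (N' - N)%:R :> R.
  by rewrite -natrM ler_nat; exact: blockS_width.
apply: (@le_trans _ _ (q.+1%:R * (b / N'%:R *+ (N' - N)))); last by rewrite ler_wpM2l.
rewrite -[_ *+ (N' - N)]mulr_natr mulrCA -[leLHS](mulfVK (lt0r_neq0 N'_gt0)).
by rewrite ler_wpM2l// divr_ge0// ltW.
Qed.

(** Each [b k] is charged to block [k.+1]. Blocks are adjacent, so the charges add up over a single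
    range of the series of [g]. *)
Lemma block_series_lty {R : realType} (q N0 : nat) (b g : nat -> R) :
  (0 < q)%N -> (0 < N0)%N -> (forall k, 0 <= b k) -> (forall m, 0 <= g m) ->
  (forall k m, (block q N0 k.+1 <= m < block q N0 k.+2)%N -> b k <= m%:R * g m) ->
  (\sum_(1 <= m <oo) (g m)%:E < +oo)%E -> (\sum_(0 <= k <oo) (b k)%:E < +oo)%E.
Proof.
move=> q0 N00 b0 g0 bg; set G := (\sum_(1 <= m <oo) _)%E => Goo.
have partial K : \sum_(0 <= k < K) b k <=
    q.+1%:R * \sum_(block q N0 1 <= m < block q N0 K.+1) g m.
  elim: K => [|K IH]; first by rewrite !big_geq// mulr0.
  have h1 : (block q N0 1 <= block q N0 K.+1)%N by exact: leq_block.
  have h2 : (block q N0 K.+1 <= block q N0 K.+2)%N by exact: leq_block.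
  rewrite big_nat_recr//= (big_cat_nat h1 h2)/= mulrDr lerD//.
  by apply: le_block_sum => //; exact: bg.
apply: (@le_lt_trans _ _ (q.+1%:R%:E * G)%E).
  apply: lime_le; first by apply: is_cvg_nneseries => n _ _; rewrite lee_fin.
  apply: nearW => K; rewrite sumEFin.
  apply: (@le_trans _ _ (q.+1%:R * \sum_(block q N0 1 <= m < block q N0 K.+1) g m)%:E).
    by rewrite lee_fin.
  rewrite EFinM lee_wpmul2l ?lee_fin//.
  apply: le_trans (nneseries_lim_ge (block q N0 K.+1) _); last by move=> *; rewrite lee_fin.
  rewrite sumEFin lee_fin [leRHS](big_cat_nat (n := block q N0 1))//=.
  - by rewrite lerDr sumr_ge0.
  - by have := block_ge q N0 1; lia.
  - exact: leq_block.
by rewrite lte_mul_pinfty// ?lee_fin.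
Qed.

(** * Borel-Cantelli along the blocks *)

Unset Implicit Arguments.

Theorem theorem3p1 (R : realType)
  (d : measure_display) (T : measurableType d) (P : probability T R)
  (U V : nat -> nat -> T -> R)
  (d' : measure_display) (T' : measurableType d') (P' : probability T' R)
  (Y : nat -> T' -> R)
  (p : nat -> nat) (a : nat -> R) (lambda : R) :
  (* the array (U_{k,i}, V_{k,i}), k,i >= 1, is i.i.d. (two-dimensional random vectors) *)
  (forall k i, measurable_fun setT (U k i)) ->
  (forall k i, measurable_fun setT (V k i)) ->
  mutual_indep P [set ki : nat * nat | (1 <= ki.1)%N /\ (1 <= ki.2)%N]
    (fun ki x => (U ki.1 ki.2 x, V ki.1 ki.2 x)) ->
  (forall k i, (1 <= k)%N -> (1 <= i)%N ->
     same_law P P (fun x => (U k i x, V k i x)) (fun x => (U 1%N 1%N x, V 1%N 1%N x))) ->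
  (* p_n : nondecreasing sequence of positive integers *)
  (forall n, (1 <= n)%N -> (0 < p n)%N) ->
  (forall m n, (1 <= m)%N -> (m <= n)%N -> (p m <= p n)%N) ->
  (* Y_n, n >= 1, i.i.d. with Y_1 distributed as U_{1,1} V_{1,2} *)
  (forall n, measurable_fun setT (Y n)) ->
  mutual_indep P' [set n : nat | (1 <= n)%N] Y ->
  (forall n, (1 <= n)%N -> same_law P' P' (Y n) (Y 1%N)) ->
  same_law P' P (Y 1%N) (fun x => U 1%N 1%N x * V 1%N 2%N x) ->
  (* a_n > 0, a_n nondecreasing, a_n -> +oo *)
  (forall n, (1 <= n)%N -> 0 < a n) ->
  (forall m n, (1 <= m)%N -> (m <= n)%N -> a m <= a n) ->
  ((fun n => (a n)%:E) @ \oo --> +oo%E) ->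
  (* lim_{c -> 1+} limsup_n a_[cn] / a_n = 1 *)
  ((fun c : R => limn_esup (fun n => (a (Num.truncn (c * n%:R)) / a n)%:E))
     @ 1^'+ --> 1%:E) ->
  (* S_n / a_n -> 0 in probability *)
  (forall eps : R, 0 < eps ->
     (fun n => P' [set x | eps < `| Ssum Y n x / a n |]) @ \oo --> 0%E) ->
  (* sum_n p_n^2 / n * P(|S_n| / a_n > lambda) < oo, with 0 < lambda < oo *)
  0 < lambda ->
  (\sum_(1 <= n <oo) (((p n)%:R ^+ 2 / n%:R)%:E *
      P' [set x | (lambda < `| Ssum Y n x | / a n)%R]) < +oo)%E ->
  (* conclusion: limsup_n T_n / a_n <= lambda a.s. *)
  {ae P, forall x, (limn_esup (fun n => (Tstat U V p n x / a n)%:E) <= lambda%:E)%E}.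
Proof.
move=> mU mV iUV lUV _ p_nd mY iY lY lYUV a0 a_nd a_oo alim Sa0 lambda0 sum_lty.
have mS n : measurable_fun setT (Ssum Y n) by exact: measurable_sum.
(* Intersecting the almost sure events for [eps = 1 / (n + 1)] gives the bound [lambda]. *)
suff main eps : 0 < eps ->
    \forall x \ae P, (limn_esup (fun n => (Tstat U V p n x / a n)%:E) <= (lambda + eps)%:E)%E.
  have pos n : 0 < n.+1%:R^-1 :> R by rewrite invr_gt0.
  apply: filterS (ae_foralln (fun n => main _ (pos n))) => x hx.
  apply/lee_addgt0Pr => e e0; apply: le_trans (hx (Num.truncn e^-1)) _.
  rewrite -EFinD lee_fin lerD2l -[leRHS]invrK lef_pV2 ?posrE ?invr_gt0//.
  by rewrite ltW// truncnS_gt.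
move=> eps0.
(* The 1 ensures [a m <= 2 * a (N k)], as [hN2] requires; the other term ensures
   [lambda * a m <= x k]. *)
pose delta := Num.min 1 (eps / 2 / lambda).
have delta0 : 0 < delta by rewrite lt_min ltr01 !divr_gt0.
have delta1 : delta <= 1 by rewrite ge_min lexx.
have delta_lambda : delta * lambda <= eps / 2.
  by rewrite -ler_pdivlMr// ge_min lexx orbT.
have [c c1 [N1 hN1]] := slow_growth alim a0 a_nd delta0.
have eps20 : 0 < eps / 2 by exact: divr_gt0.
have [N2 hN2] := uniform_half_bound mS eps20 a0 a_nd a_oo Sa0.
(* Chosen so that [1 + 8/q < c], where [1 + 8/q] is the two-block growth bound of [blockSS_le]. *)
pose q := (Num.truncn (8 / (c - 1))).+1.
have q8 : 8 < q%:R * (c - 1) by rewrite -ltr_pdivrMr ?subr_gt0// truncnS_gt.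
pose N0 := maxn q (maxn N1 N2).
have N0_gt0 : (0 < N0)%N by rewrite leq_max.
pose N k := block q N0 k.
have leN k : (N0 <= N k)%N by exact: leq_trans (leq_addr _ _) (block_ge q N0 k).
have N_gt0 k : (0 < N k)%N by exact: leq_trans (leN k).
have growth k m : (1 <= m)%N -> (m <= N k.+2)%N -> a m <= (1 + delta) * a (N k).
  move=> m1 mN; apply: hN1 => //.
    by apply: leq_trans (leN k); rewrite !leq_max leqnn orbT.
  have qm : (q * m <= (q + 8) * N k)%N.
    rewrite (leq_trans (leq_mul (leqnn q) mN))//; apply: blockSS_le => //.
    by rewrite leq_max leqnn.
  have q_gt0 : 0 < q%:R :> R by rewrite ltr0n.
  rewrite -(ler_pM2l q_gt0) mulrA; move: qm; rewrite -(ler_nat R) !natrM natrD => qm.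
  apply: le_trans qm _; apply: ler_wpM2r => //; lra.
(* The level [(lambda + eps) * a (N k)] is split into [x k], for the walk at its final time, and
   [y k], for its increments. *)
pose x k := (lambda + eps / 2) * a (N k).
pose y k := eps / 2 * a (N k).
pose E k i j n := [set w | x k + y k < `|\sum_(1 <= l < n.+1) U l i w * V l j w|].
(* Taking all times up to [N k.+1] and the index range of the last one covers every [n] between
   [N k] and [N k.+1]. *)
pose B k := \big[setU/set0]_(1 <= i < (p (N k.+1)).+1)
  \big[setU/set0]_(1 <= j < (p (N k.+1)).+1 | i != j)
  \big[setU/set0]_(n < (N k.+1).+1) E k i j n.
have mE k i j n : measurable (E k i j n).
  rewrite -[X in measurable X]setTI.
  apply: (measurable_fun_ltr (measurable_cst _)) => //; apply: measurableT_comp => //.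
  by apply: measurable_sum => l; exact: measurable_funM.
have mB k : measurable (B k).
  by do 3 (apply: bigsetU_measurable => ? _).
pose h m := P' [set w | (lambda < `|Ssum Y m w| / a m)%R].
have mh m : measurable [set w | lambda < `|Ssum Y m w| / a m].
  rewrite -[X in measurable X]setTI; apply: (measurable_fun_ltr (measurable_cst _)) => //.
  by apply: measurable_funM => //; exact: measurableT_comp.
have hfin m : h m = (fine (h m))%:E by rewrite fineK// fin_num_measure.
(* For [m] in the next block, [p (N k.+1) <= p m] and [lambda * a m <= x k]. *)
have PB k m : (N k.+1 <= m < N k.+2)%N ->
    (P (B k) <= ((p m)%:R ^+ 2)%:E * (2%:E * h m))%E.
  move=> /andP[Nm mN].
  have m1 : (1 <= m)%N by exact: leq_trans Nm.
  have am := growth k m m1 (ltnW mN).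
  have aN := a0 _ (N_gt0 k).
  apply: le_trans (array_union_bound mU mV iUV lUV mY iY lY lYUV (p (N k.+1)) (x k) Nm _) _.
    move=> l lm; apply: hN2 lm; first by apply: leq_trans (leN k); rewrite !leq_max leqnn !orbT.
    by apply: le_trans am _; apply: ler_wpM2r; [exact: ltW|lra].
  apply: lee_pmul => //.
  - by rewrite mule_ge0.
  - by rewrite lee_fin lerXn2r ?nnegrE// ler_nat p_nd.
  apply: lee_wpmul2l => //; apply: le_measure; rewrite ?inE//.
    rewrite -[X in measurable X]setTI; apply: (measurable_fun_ltr (measurable_cst _)) => //.
    exact: measurableT_comp.
  move=> w /=; rewrite ltr_pdivlMr ?a0//; apply: le_lt_trans.
  rewrite /x; nra.
(* The 2 is Ottaviani's; multiplying [g m] by [m] cancels the weight [1 / m]. *)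
pose g m := 2 * ((p m)%:R ^+ 2 / m%:R * fine (h m)).
have Bsum : (\sum_(0 <= k <oo) P (B k) < +oo)%E.
  have -> : (\sum_(0 <= k <oo) P (B k) = \sum_(0 <= k <oo) (fine (P (B k)))%:E)%E.
    by apply: eq_eseriesr => k _; rewrite fineK// fin_num_measure.
  apply: (@block_series_lty _ q N0 _ g) => //.
  - by move=> k; exact: fine_ge0.
  - by move=> m; rewrite !mulr_ge0// fine_ge0.
  - move=> k m kNm; have := PB k m kNm; rewrite hfin.
    rewrite -[P (B k)]fineK ?fin_num_measure// -!EFinM lee_fin => /le_trans; apply.
    have m0 : m%:R != 0 :> R by rewrite pnatr_eq0 -lt0n (leq_trans (N_gt0 k.+1))//; case/andP: kNm.
    by rewrite /g le_eqVlt; apply/orP; left; apply/eqP; field.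
  rewrite /g; under eq_eseriesr do rewrite EFinM EFinM -hfin.
  rewrite nneseriesZl; last by move=> m _; rewrite mule_ge0.
  by rewrite lte_mul_pinfty.
(* The exceptional set: infinitely many [B k] occur, a null event by Borel-Cantelli. *)
exists (lim_sup_set B); split.
- by apply: bigcapT_measurable => n; exact: bigcup_measurable.
- exact: lim_sup_set_cvg0.
move=> w /= nle; apply: contrapT => nB; apply: nle.
have [K hK] : exists K, forall k, (K <= k)%N -> ~ B k w.
  apply: contrapT => nK; apply: nB => K _; apply: contrapT => nBK; apply: nK.
  by exists K => k Kk Bkw; apply: nBK; exists k.
apply: (@le_trans _ _ (ereal_sup [set (Tstat U V p n w / a n)%:E | n in [set n | (N K <= n)%N]])).
  by apply: ereal_inf_lbound; exists [set n | (N K <= n)%N] => //; exists (N K).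
apply: ge_ereal_sup => _ [n /= Kn <-]; rewrite lee_fin.
have [k Kk /andP[kn nk]] := block_cover Kn.
have n1 : (1 <= n)%N by exact: leq_trans kn.
rewrite ler_pdivrMr ?a0//.
(* Since [N k <= n], the level [(lambda + eps) * a (N k)] is at most [(lambda + eps) * a n]. *)
apply: (@le_trans _ _ (x k + y k)); last first.
  rewrite /x /y -mulrDl -addrA -splitr ler_wpM2l//; first by rewrite ltW// addr_gt0.
  exact: a_nd.
have aN := a0 _ (N_gt0 k).
have xy0 : 0 <= x k + y k by rewrite addr_ge0// mulr_ge0// ltW// ?addr_gt0.
have pn : (p n <= p (N k.+1))%N by apply: p_nd => //; exact: ltnW.
(* Both maxima start from 0, so [xy0] is used besides the bound on each entry. *)
rewrite /Tstat big_seq; apply: bigmax_le => // i; rewrite mem_index_iota => /andP[i1 ip].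
rewrite big_seq_cond; apply: bigmax_le => // j.
rewrite mem_index_iota => /andP[/andP[j1 jp] ij].
rewrite leNgt; apply/negP => Ew; apply: (hK k Kk).
rewrite /B -bigcup_seq; exists i => /=.
  by rewrite mem_index_iota i1 (leq_trans ip).
rewrite -bigcup_seq_cond; exists j => /=.
  by rewrite mem_index_iota j1 (leq_trans jp).
rewrite -(bigcup_mkord _ (E k i j)); exists n => //=.
exact: ltnW.
Qed.
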